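(* Let $k$ be a field of prime characteristic $p$. Consider the hypersurface $$R=\frac{k[t,u,v,x,y]}{(r_0u^2x^2+r_1uxvy+r_2v^2y^2)},$$ where $r_0,r_1,r_2$ are polynomials in $k[t]$. Let $I=(u,v,x,y)$. Suppose that $r_0r_2$ is nonzero and that $2\deg r_1>\deg r_0+\deg r_2$. Then there is a constant $c$ such that for each $q=p^e$ there is a primary decomposition $$I^{[q]}=Q_1\cap Q_2\cap\cdots\cap Q_s$$ satisfying $(\sqrt{Q_i})^{c[q]}\subseteq Q_i$ for all $i=1,\ldots,s$.
   Context: For an ideal $J$ of a ring of prime characteristic $p$ and $q=p^e$ ($e\ge 0$ an integer), the Frobenius power $J^{[q]}$ is the ideal generated by the $q$th powers of generators of $J$. The notation $J^{c[q]}$ means $(J^c)^{[q]}$, the $q$th Frobenius power of the ordinary $c$th power of $J$; $c$ is a positive integer. The number $s$ of components may depend on $q$. Degrees of $r_0,r_1,r_2$ are degrees in $t$. *)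

(* Defs.v *)
From HB Require Import structures.
From mathcomp Require Import all_boot all_order all_algebra ring_quotient.
From mathcomp Require Import boolp classical_sets.
From mathcomp Require Import mpoly.
Set Implicit Arguments.
Unset Strict Implicit.
Unset Printing Implicit Defensive.

Import GRing.Theory.
Local Open Scope ring_scope.
Local Open Scope classical_set_scope.

Section Ideals.
Variable R : comNzRingType.
Implicit Types (J Q : set R) (S : set R).

(* Ideals are Prop-valued, and may be improper, unlike the decidable proper    *)
(* ideals of ring_quotient.                                                    *)
Definition is_ideal J : Prop :=
  [/\ J 0, forall a b, J a -> J b -> J (a + b) & forall a b, J b -> J (a * b)].

Definition gen_ideal S : set R := smallest is_ideal S.

Definition ideal_pow J (n : nat) : set R :=
  gen_ideal [set a | exists f : 'I_n -> R,
                       (forall i, J (f i)) /\ a = \prod_(i < n) f i].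

(* J^[q]. All elements of J are taken as its generators; by frob_pow_gen below *)
(* any other generating set gives the same ideal when q is a power of the      *)
(* characteristic.                                                             *)
Definition frob_pow J (q : nat) : set R := gen_ideal [set a ^+ q | a in J].

Definition radical J : set R := [set a | exists n : nat, J (a ^+ n)].

Definition is_primary Q : Prop :=
  [/\ is_ideal Q, ~ Q 1 & forall a b, Q (a * b) -> Q a \/ radical Q b].

Definition is_primary_decomposition J (s : nat) (Q : 'I_s -> set R) : Prop :=
  (forall i, is_primary (Q i)) /\ J = \bigcap_i Q i.

Lemma gen_ideal_is_ideal S : is_ideal (gen_ideal S).
Proof.
split=> [A [[]]//|a b Ja Jb A AP|a b Jb A AP].
- by have [[_ addA _] _] := AP; apply: addA; [apply: Ja|apply: Jb].
- by have [[_ _ mulA] _] := AP; apply: mulA; apply: Jb.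
Qed.

Lemma frob_pow_gen (p e : nat) S : p \in [pchar R] ->
  frob_pow (gen_ideal S) (p ^ e)%N = gen_ideal [set a ^+ (p ^ e) | a in S].
Proof.
move=> pR; have p_prime : prime p := pcharf_prime pR.
have qR : [pchar R].-nat (p ^ e)%N by rewrite pnatX (pnatE _ p_prime) pR.
have q_gt0 : (0 < p ^ e)%N by rewrite expn_gt0 prime_gt0.
rewrite eqEsubset; split; apply: smallest_sub; try exact: gen_ideal_is_ideal.
- move=> _ [a Sa <-].
  set T := gen_ideal _; have [T0 TD TM] : is_ideal T by exact: gen_ideal_is_ideal.
  suff : [set x | T (x ^+ (p ^ e))] a by [].
  apply: Sa; split; last by move=> x Sx; apply: sub_gen_smallest; exists x.
  split=> [|x y Tx Ty|x y Ty] /=.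
  + by rewrite expr0n -(negbK (_ == _)) -lt0n q_gt0.
  + by rewrite exprDn_pchar //; apply: TD.
  + by rewrite exprMn; apply: TM.
- move=> _ [a Sa <-]; apply: sub_gen_smallest; exists a => //.
  exact: sub_gen_smallest.
Qed.

End Ideals.

Section Hypersurface.
Variables (k : fieldType) (r0 r1 r2 : {poly k}).

(* k[t,u,v,x,y], with the variables numbered in this order. *)
Local Notation A := {mpoly k[5]}.
Local Notation tA := ('X_(@Ordinal 5 0 isT) : A).
Local Notation uA := ('X_(@Ordinal 5 1 isT) : A).
Local Notation vA := ('X_(@Ordinal 5 2 isT) : A).
Local Notation xA := ('X_(@Ordinal 5 3 isT) : A).
Local Notation yA := ('X_(@Ordinal 5 4 isT) : A).

Definition in_t (r : {poly k}) : A := (map_poly (@mpolyC 5 k) r).[tA].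

Definition hypersurface_eq : A :=
  in_t r0 * uA ^+ 2 * xA ^+ 2 + in_t r1 * uA * xA * vA * yA
  + in_t r2 * vA ^+ 2 * yA ^+ 2.

Definition hypersurface_ideal : {pred A} :=
  fun f => `[< exists h, f = h * hypersurface_eq >].

Lemma hypersurface_ideal_closed : idealr_closed hypersurface_ideal.
Proof.
split=> [|| a f g /asboolP[h ->] /asboolP[h' ->]].
- by apply/asboolP; exists 0; rewrite mul0r.
- apply/asboolP => -[h] /(congr1 (meval (fun=> 0))) /eqP.
  rewrite meval1 mevalM /hypersurface_eq !mevalD !mevalM !mevalXU.
  by rewrite !mulr0 !addr0 mulr0 oner_eq0.
- by apply/asboolP; exists (a * h + h'); rewrite mulrDl mulrA.
Qed.

HB.instance Definition _ :=
  isIdealr.Build A hypersurface_ideal hypersurface_ideal_closed.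

Definition hypersurface : comNzRingType := {ideal_quot hypersurface_ideal}.

Definition hypersurface_pi (f : A) : hypersurface :=
  (\pi_({ideal_quot hypersurface_ideal}) f)%qT.

Definition ideal_uvxy : set hypersurface :=
  gen_ideal [set hypersurface_pi uA; hypersurface_pi vA;
                 hypersurface_pi xA; hypersurface_pi yA].

End Hypersurface.

Arguments ideal_uvxy {k} r0 r1 r2 _.

(* Main.v *)
Require Import Defs.
From mathcomp Require Import all_boot all_order all_algebra ring_quotient.
From mathcomp Require Import boolp classical_sets.
From mathcomp Require Import mpoly.
Set Implicit Arguments.
Unset Strict Implicit.
Unset Printing Implicit Defensive.

Import GRing.Theory.
Local Open Scope ring_scope.
Local Open Scope classical_set_scope.

(** Write P = k[t], J = I^[q] and M = R/J. Since (u,v,x,y) has no t in it, M is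
    a finitely generated P-module, generated by the monomials u^a v^b x^c y^d
    with exponents below q, and R/I = P. Every prime over J contains I, so it
    is either I or I + (g) with g irreducible in P. This suggests the
    components: for I the preimage Q_0 of the P-torsion of M, and for I + (g)
    the ideal Q_g = J + (g^N).

    For b in R with value r in P at u = v = x = y = 0, b^q is congruent to r^q
    modulo J. This reduces everything about these components to
    divisibility in P: they are primary, their radicals are I and I + (g), and
    a product of c elements of the radical of Q_g has its q-th power in
    J + (g^(cq)), so that N = cq is allowed ([component_spec]). If h kills the
    torsion of M and g runs over the irreducible factors of h, then Q_0 and the
    Q_g intersect in J, as soon as g^(cq) kills all g-power torsion of M
    ([decomposition_of_torsion]).

    What has to be proved is therefore a bound on the g-power torsion of M that
    is linear in q and uniform in g. The equation of R is homogeneous for the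
    grading of u^a v^b x^c y^d by (a + b, c + d, a + d), and at most q
    monomials with exponents below q share a degree, as a determines the
    others. Hence M is a direct sum of cokernels of matrices over P with at
    most q rows, whose entries are among r_0, r_1, r_2 and 0. By Cramer's rule
    a nonzero minor of maximal size kills the torsion of such a cokernel
    ([matrix_torsion]), and its degree is at most q times the largest degree of
    an r_i. So g divides it at most that often, whatever g is
    ([ideal_irreducible_power], [graded_linear_torsion]). *)

(** * Powers of an irreducible polynomial in an ideal of k[t] *)

Lemma irreducible_prod_factor (k : fieldType) (h : {poly k}) : h != 0 ->
  exists2 s : seq {poly k},
    (forall g, g \in s -> irreducible_poly g) & h %= \prod_(g <- s) g.
Proof.
have [n] := ubnP (size h); elim: n h => // n IHn h; rewrite ltnS => le_hn h0.
have [h_le1 | h_gt1] := leqP (size h) 1.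
  exists [::] => //; rewrite big_nil -size_poly_eq1 eqn_leq h_le1.
  by rewrite size_poly_gt0.
have [irr_h | red_h] := EM (irreducible_poly h).
  by exists [:: h]; [move=> g /[!inE] /eqP-> | rewrite big_seq1 eqpxx].
have [g [g_n1 g_dvd g_neq]] :
    exists g : {poly k}, [/\ size g != 1, g %| h & ~ (g %= h)].
  apply: contrapT => none; apply: red_h; split=> // g g1 gh.
  by apply: contrapT => ngh; apply: none; exists g.
have [b def_h] := dvdpP _ _ g_dvd.
have /andP[b0 g0] : (b != 0) && (g != 0).
  by rewrite -negb_or -mulf_eq0 -def_h.
have lt_g : (size g < size h)%N.
  by rewrite ltn_neqAle dvdp_size_eqp // dvdp_leq // andbT; apply/negP.
have lt_b : (size b < size h)%N.
  rewrite def_h size_mul //; move: g_n1 g0; rewrite -size_poly_gt0.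
  by case: (size g) => [|[|m]] // _ _; rewrite !addnS /= ltnS leq_addr.
have [s irr_s eq_s] := IHn b (leq_trans lt_b le_hn) b0.
have [s' irr_s' eq_s'] := IHn g (leq_trans lt_g le_hn) g0.
exists (s ++ s'); last first.
  rewrite big_cat def_h.
  exact: eqp_trans (eqp_mulr _ eq_s) (eqp_mull _ eq_s').
by move=> f; rewrite mem_cat => /orP[/irr_s | /irr_s'].
Qed.

Lemma split_power_of_irreducible (k : fieldType) (g d : {poly k}) :
    (1 < size g)%N -> d != 0 ->
  exists a d', [/\ d = g ^+ a * d', ~~ (g %| d') & (a < size d)%N].
Proof.
move=> g_gt1; have [n] := ubnP (size d); elim: n d => // n IHn d.
rewrite ltnS => le_dn d0.
have [/dvdpP[b def_d] | ndvd] := boolP (g %| d); last first.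
  by exists 0, d; rewrite expr0 mul1r size_poly_gt0.
have b0 : b != 0 by apply: contraNneq d0 => b0; rewrite def_d b0 mul0r.
have g0 : g != 0 by rewrite -size_poly_gt0 ltnW.
have lt_bd : (size b < size d)%N.
  rewrite def_d size_mul //; case: (size g) g_gt1 => [|[|m]] // _.
  by rewrite !addnS /= ltnS leq_addr.
have [a [d' [def_b nd' lt_a]]] := IHn b (leq_trans lt_bd le_dn) b0.
exists a.+1, d'; split=> //; last exact: leq_ltn_trans lt_a lt_bd.
by rewrite def_d def_b exprS mulrC mulrA.
Qed.

Lemma irreducible_coprime (k : fieldType) (g d : {poly k}) :
  irreducible_poly g -> ~~ (g %| d) -> coprimep g d.
Proof.
move=> [g_gt1 irr_g] ndvd; apply: contraNT ndvd; rewrite /coprimep => n1.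
by have /eqp_dvdl <- := irr_g _ n1 (dvdp_gcdl _ _); apply: dvdp_gcdr.
Qed.

Lemma coprime_bezout (k : fieldType) (a b : {poly k}) : coprimep a b ->
  exists u v, u * a + v * b = 1.
Proof.
case/Bezout_eq1_coprimepP=> -[u v] /= <-; by exists u, v.
Qed.

(** Dividing all factors g out of d leaves a unit modulo powers of g, so by
    Bezout K contains the exact power of g in d, whose exponent is below
    [size d]. The resulting exponent [N] depends neither on [j] nor on [g]. *)
Lemma ideal_irreducible_power (k : fieldType) (K : set {poly k})
    (g d : {poly k}) (j N : nat) :
    is_ideal K -> irreducible_poly g -> d != 0 -> (size d <= N.+1)%N ->
    K d -> K (g ^+ j) -> K (g ^+ N).
Proof.
move=> [_ KD KM] irr_g d0 le_dN Kd Kgj.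
have [g_gt1 _] := irr_g.
have [a [d' [def_d ndvd lt_a]]] := split_power_of_irreducible g_gt1 d0.
have le_aN : (a <= N)%N by rewrite -ltnS (leq_trans lt_a).
have cop : coprimep (g ^+ j) d' by rewrite coprimep_expl ?irreducible_coprime.
have [u [v uv1]] := coprime_bezout cop.
rewrite -(subnK le_aN) exprD; apply: (KM).
rewrite -[X in K X]mulr1 -uv1 mulrDr; apply: KD.
  by rewrite mulrA; apply: KM.
by rewrite mulrCA -def_d; apply: KM.
Qed.

(** * Primary decomposition from bounded torsion *)

(** Here H plays the role of R, with [iota] the inclusion of k[t], and J that
    of I^[q]. [retractJ] expresses that H is k[t] plus an ideal whose elements
    have their q-th powers in J, and [inertJ] that k[t] embeds in H / J. *)
Section PrimaryComponents.
Variables (k : fieldType) (H : comNzRingType).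
Variables (iota : {rmorphism {poly k} -> H}) (q c : nat) (J : set H).
Hypothesis qH : [pchar H].-nat q.
Hypothesis c_gt0 : (0 < c)%N.
Hypothesis idealJ : is_ideal J.
Hypothesis retractJ : forall z, exists r, J (z ^+ q - iota (r ^+ q)).
Hypothesis inertJ : forall r, J (iota r) -> r = 0.

Lemma idealB (Q : set H) a b : is_ideal Q -> Q a -> Q b -> Q (a - b).
Proof. by move=> [_ QD QM] Qa Qb; rewrite -mulN1r; apply/QD/QM. Qed.

Lemma ideal_cong (Q : set H) a b : is_ideal Q -> Q (a - b) -> Q a <-> Q b.
Proof.
move=> idQ; have [_ QD _] := idQ; move=> Qab; split=> [Qa|Qb].
  by rewrite -(subKr a b); apply: idealB.
by rewrite -(subrK b a); apply: QD.
Qed.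

Lemma ideal_prod_cong (Q : set H) (I : Type) (s : seq I) (a b : I -> H) :
  is_ideal Q -> (forall i, Q (a i - b i)) ->
  Q (\prod_(i <- s) a i - \prod_(i <- s) b i).
Proof.
move=> idQ Qab; have [Q0 QD QM] := idQ.
elim: s => [|i s IHs]; first by rewrite !big_nil subrr.
rewrite !big_cons.
set A := \prod_(j <- s) a j; set B := \prod_(j <- s) b j.
have -> : a i * A - b i * B = A * (a i - b i) + b i * (A - B).
  by rewrite !mulrBr addrA (mulrC A) (mulrC A) subrK.
by apply: QD; apply: QM.
Qed.

Lemma ideal_exp_cong (Q : set H) a b n :
  is_ideal Q -> Q (a - b) -> Q (a ^+ n - b ^+ n).
Proof.
move=> idQ Qab; have [_ _ QM] := idQ.
by rewrite subrXX mulrC; apply: QM.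
Qed.

Lemma idealX (Q : set H) a n : is_ideal Q -> (0 < n)%N -> Q a -> Q (a ^+ n).
Proof. by move=> [_ _ QM]; case: n => // n _ Qa; rewrite exprSr; apply: QM. Qed.

Lemma q_gt0 : (0 < q)%N. Proof. by case/andP: qH. Qed.

(** The contraction of Q to k[t] has radical (g), and the elements of k[t]
    outside (g) are nonzerodivisors on H / Q. Since b^q is in k[t] modulo J
    for every b, this shows both that Q is primary and which elements are in
    its radical. The case g = 0 is the one of the torsion component. *)
Lemma component_spec (g : {poly k}) (Q : set H) :
    is_ideal Q -> J `<=` Q -> ~ Q 1 -> Q (iota (g ^+ (c * q))) ->
    (forall r a, ~~ (g %| r) -> Q (iota r * a) -> Q a) ->
  is_primary Q /\ frob_pow (ideal_pow (radical Q) c) q `<=` Q.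
Proof.
move=> idQ JQ nQ1 Qg cancelQ; have [Q0 QD QM] := idQ.
have cancelX r n a : ~~ (g %| r) -> Q (iota (r ^+ n) * a) -> Q a.
  move=> ndvd; elim: n a => [|n IHn] a; first by rewrite expr0 rmorph1 mul1r.
  by rewrite exprS rmorphM -mulrA => /(cancelQ _ _ ndvd)/IHn.
have radE a r : J (a ^+ q - iota (r ^+ q)) -> radical Q a -> g %| r.
  move=> /JQ Qar [n Qan]; apply: contrapT => /negP ndvd; apply: nQ1.
  apply: (cancelX r (q * n)%N) => //; rewrite mulr1 exprM rmorphXn.
  apply/(ideal_cong idQ (ideal_exp_cong n idQ Qar)).
  by rewrite -exprM mulnC exprM; apply: idealX => //; exact: q_gt0.
split.
- split=> // a b Qab.
  have [r Jbr] := retractJ b; have [/dvdpP[u def_r] | ndvd] := boolP (g %| r).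
    right; exists (q * (c * q))%N; rewrite exprM.
    apply/(ideal_cong idQ (ideal_exp_cong _ idQ (JQ _ Jbr))).
    rewrite -rmorphXn -exprM mulnC exprM def_r exprMn rmorphXn.
    by apply: idealX; [| exact: q_gt0 | rewrite rmorphM; apply: QM].
  left; apply: (cancelX r q) => //.
  have Qd : Q (iota (r ^+ q) * a - b ^+ q * a).
    by rewrite -mulrBl mulrC -opprB; apply/QM; rewrite -mulN1r; apply/QM/JQ.
  apply/(ideal_cong idQ Qd).
  rewrite -[q]prednK ?q_gt0 // exprSr -mulrA (mulrC b); exact: QM.
- apply: smallest_sub => // _ [z zIc <-].
  (* As q is a power of the characteristic, {x | x^q in Q} is an ideal. *)
  suff : [set x | Q (x ^+ q)] z by [].
  apply: zIc; split; first split=> [|x y Qx Qy|x y Qy] /=.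
  + by rewrite expr0n -(negbK (_ == _)) -lt0n q_gt0.
  + by rewrite exprDn_pchar //; apply: QD.
  + by rewrite exprMn; apply: QM.
  + move=> _ [f [radf ->]] /=.
    have [r Jr] := choice (fun i => retractJ (f i)).
    rewrite -prodrXl.
    apply/(ideal_cong idQ (ideal_prod_cong _ idQ (fun i => JQ _ (Jr i)))).
    have /choice[u def_r] : forall i, exists u, r i = u * g.
      by move=> i; apply/dvdpP/(radE _ _ (Jr i)).
    rewrite -rmorph_prod.
    under eq_bigr do rewrite def_r exprMn.
    rewrite big_split /= rmorphM; apply: QM.
    by rewrite prodr_const card_ord -exprM mulnC.
Qed.

Definition torsion_component : set H :=
  [set z | exists2 h : {poly k}, h != 0 & J (iota h * z)].

Definition power_component (g : {poly k}) : set H :=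
  [set z | exists w, J (z - iota (g ^+ (c * q)) * w)].

Lemma torsion_component_spec :
  is_primary torsion_component /\
  frob_pow (ideal_pow (radical torsion_component) c) q `<=` torsion_component.
Proof.
have [J0 JD JM] := idealJ.
apply: (@component_spec 0).
- split=> [|a b [h h0 Ja] [h' h'0 Jb]|a b [h h0 Jb]].
  + by exists 1; rewrite ?oner_eq0 // mulr0.
  + exists (h * h'); first by rewrite mulf_neq0.
    rewrite rmorphM mulrDr; apply: JD; last by rewrite -mulrA; apply: JM.
    by rewrite (mulrC (iota h)) -mulrA; apply: JM.
  + by exists h => //; rewrite mulrCA; apply: JM.
- by move=> z Jz; exists 1; rewrite ?oner_eq0 // rmorph1 mul1r.
- by case=> h h0; rewrite mulr1 => /inertJ h00; rewrite h00 eqxx in h0.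
- exists 1; rewrite ?oner_eq0 // expr0n muln_eq0 !gtn_eqF // ?q_gt0 //.
  by rewrite rmorph0 mulr0.
- move=> r a; rewrite dvd0p => r0 [h h0 Jh]; exists (h * r).
    by rewrite mulf_neq0.
  by rewrite rmorphM -mulrA.
Qed.

Lemma power_component_spec g : irreducible_poly g ->
  is_primary (power_component g) /\
  frob_pow (ideal_pow (radical (power_component g)) c) q
    `<=` power_component g.
Proof.
have [J0 JD JM] := idealJ; move=> irr_g; have [g_gt1 _] := irr_g.
set G : {poly k} := g ^+ (c * q).
have idQ : is_ideal (power_component g).
  split=> [|a b [v Ja] [w Jb]|a b [w Jb]].
  + by exists 0; rewrite mulr0 subr0.
  + by exists (v + w); rewrite mulrDr opprD addrACA; apply: JD.
  + by exists (a * w); rewrite mulrCA -mulrBr; apply: JM.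
apply: (@component_spec g) => //.
- by move=> z Jz; exists 0; rewrite mulr0 subr0.
- case=> w J1; have [r Jwr] := retractJ w.
  have : J (iota (1 - G ^+ q * r ^+ q)).
    have -> : iota (1 - G ^+ q * r ^+ q) = (1 - iota G ^+ q * w ^+ q)
                + iota G ^+ q * (w ^+ q - iota (r ^+ q)).
      rewrite mulrBr addrA subrK rmorphB rmorph1 rmorphM.
      by rewrite -(rmorphXn iota q G).
    apply: JD; last exact: JM.
    rewrite -exprMn -[X in X - _](expr1n _ q); exact: ideal_exp_cong.
  move/inertJ/eqP; rewrite subr_eq0 => /eqP G1.
  have : g %| 1.
    rewrite G1 dvdp_mulr // -exprM dvdp_exp //.
    by rewrite !muln_gt0 c_gt0 q_gt0.
  by rewrite dvdp1 gtn_eqF.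
- by exists 1; rewrite mulr1 subrr.
- move=> r a ndvd Qra; have [_ QD QM] := idQ.
  have cop : coprimep G r by rewrite coprimep_expl ?irreducible_coprime.
  have [u [v uv1]] := coprime_bezout cop.
  rewrite -[a]mul1r -(rmorph1 iota) -uv1 rmorphD mulrDl; apply: QD.
    exists (iota u * a); rewrite rmorphM -mulrA mulrCA subrr; exact: J0.
  by rewrite rmorphM -mulrA; apply: QM.
Qed.

Hypothesis finite_torsion :
  exists2 h : {poly k}, h != 0 &
    forall z, torsion_component z -> J (iota h * z).
Hypothesis linear_torsion : forall (g : {poly k}) j z,
  irreducible_poly g -> J (iota (g ^+ j) * z) -> J (iota (g ^+ (c * q)) * z).

(** To see that the intersection is J, take z in it. Then a product of
    irreducible factors kills z modulo J, and one factor g can be removed at a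
    time: z is g^(cq) w modulo J, so g^(cq+1) kills h' w when g h' kills z, and
    by [linear_torsion] already g^(cq) kills h' w, that is, h' kills z. *)
Theorem decomposition_of_torsion : exists (s : nat) (Q : 'I_s -> set H),
  is_primary_decomposition J Q /\
  forall i, frob_pow (ideal_pow (radical (Q i)) c) q `<=` Q i.
Proof.
have [J0 JD JM] := idealJ.
have [h h0 tors_h] := finite_torsion.
have [s irr_s eq_hs] := irreducible_prod_factor h0.
pose Q (i : 'I_(size s).+1) : set H :=
  if unlift ord0 i is Some j then power_component s`_j else torsion_component.
have specQ i : is_primary (Q i) /\
               frob_pow (ideal_pow (radical (Q i)) c) q `<=` Q i.
  rewrite /Q; case: unliftP => [j|] _; last exact: torsion_component_spec.
  by apply: power_component_spec; apply/irr_s/mem_nth.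
exists (size s).+1, Q; split; last by move=> i; case: (specQ i).
split; first by move=> i; case: (specQ i).
rewrite eqEsubset; split=> [z Jz i _ | z Qz].
  rewrite /Q; case: unliftP => [j|] _.
    by exists 0; rewrite mulr0 subr0.
  by exists 1; rewrite ?oner_eq0 // rmorph1 mul1r.
have Qs g : g \in s -> power_component g z.
  move=> gs; have lt_g : (index g s < size s)%N by rewrite index_mem.
  have := Qz (lift ord0 (Ordinal lt_g)) I.
  by rewrite /Q liftK /= nth_index.
have : J (iota h * z).
  by apply: tors_h; have := Qz ord0 I; rewrite /Q unlift_none.
have /dvdpP[b def_s] : h %| \prod_(g <- s) g by rewrite (eqp_dvdl _ eq_hs).
move=> Jhz.
have {Jhz def_s}: J (iota (\prod_(g <- s) g) * z).
  by rewrite def_s rmorphM -mulrA; apply: JM.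
elim: s irr_s Qs {eq_hs Q specQ Qz} => [|g s IHs] irr_s Qs.
  by rewrite big_nil rmorph1 mul1r.
have /irr_s irr_g : g \in g :: s by exact: mem_head.
have [w Jzw] := Qs g (mem_head _ _).
rewrite big_cons; set h' := \prod_(f <- s) f => Jz.
(* z may be replaced by g^(cq) w in all multiples, as they agree modulo J. *)
have congJ a : J (iota a * z) <-> J (iota (g ^+ (c * q)) * (iota a * w)).
  apply: ideal_cong => //; rewrite mulrCA -mulrBr; exact: JM.
apply: IHs => [f fs|f fs|].
- by apply: irr_s; rewrite inE fs orbT.
- by apply: Qs; rewrite inE fs orbT.
apply/congJ; apply: (linear_torsion irr_g (j := (c * q).+1)).
by move/congJ: Jz; rewrite rmorphM exprSr rmorphM -!mulrA.
Qed.

End PrimaryComponents.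

(** * Torsion of the cokernel of a polynomial matrix *)

Lemma size_det_leq (k : fieldType) (D r : nat) (M : 'M[{poly k}]_r) :
  (forall i j, (size (M i j) <= D.+1)%N) -> (size (\det M) <= (r * D).+1)%N.
Proof.
move=> szM; rewrite /determinant; apply: leq_trans (size_sum _ _ _) _.
apply/bigmax_leqP => s _; rewrite size_Msign.
apply: leq_trans (size_poly_prod_leq _ _) _.
rewrite card_ord leq_subLR addnS ltnS -mulnS.
rewrite -[r in (r * _)%N]card_ord -sum_nat_const.
by apply: leq_sum => i _; apply: szM.
Qed.

(** Let M be a nonsingular square submatrix of A of maximal size, on the rows f
    and the columns g. Over the fraction field every column in the span of A,
    like a torsion element m, is E times its entries on the rows f, where E is
    the matrix with A = E (rows f of A). Applied to the columns g of A this
    gives columns g of A = E M, so that (columns g of A) adj(M) (m on f) equals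
    det(M) m: the minor det(M) kills the torsion. *)
Lemma matrix_torsion (k : fieldType) (a b D : nat) (A : 'M[{poly k}]_(a, b)) :
    (forall i j, (size (A i j) <= D.+1)%N) ->
  exists d : {poly k}, [/\ d != 0, (size d <= (a * D).+1)%N &
    forall h (m : 'cV_a) w, h != 0 -> h *: m = A *m w ->
      exists w', d *: m = A *m w'].
Proof.
move=> szA; pose F := @tofrac {poly k}.
have injF : injective F by move=> x y /eqP; rewrite tofrac_eq => /eqP.
pose A' := map_mx F A; pose f := maxrankfun A'.
have free_f : row_free (rowsub f A') := maxrowsub_free A'.
have full_f : row_full (rowsub f A')^T by rewrite /row_full mxrank_tr.
pose g := fullrankfun full_f; pose M := mxsub f g A.
have detM : \det (map_mx F M) != 0.
  have -> : map_mx F M = (rowsub g (rowsub f A')^T)^T.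
    by apply/matrixP=> i j; rewrite !mxE.
  by rewrite det_tr -unitfE -unitmxE fullrowsub_unit.
have d0 : \det M != 0 by rewrite -(tofrac_eq0 (\det M)) -(det_map_mx F).
exists (\det M); split=> // [|h m w h0 def_m].
  apply: (@leq_trans (\rank A' * D).+1).
    by apply: size_det_leq => i j; rewrite mxE.
  by rewrite ltnS leq_mul2r rank_leq_row orbT.
have [E def_A'] : exists E, A' = E *m rowsub f A'.
  by apply/submxP; rewrite eq_maxrowsub.
have def_m' : map_mx F m = E *m rowsub f (map_mx F m).
  have Fh0 : F h != 0 by rewrite tofrac_eq0.
  apply: (scalerI Fh0); rewrite scalemxAr.
  have -> : F h *: rowsub f (map_mx F m) = rowsub f (F h *: map_mx F m).
    by apply/matrixP=> i j; rewrite !mxE.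
  rewrite -map_mxZ def_m map_mxM.
  by rewrite -/A' -mul_rowsub_mx mulmxA -def_A'.
(* The factor [colsub g 1%:M] selects the columns g of A. *)
exists (colsub g 1%:M *m (\adj M *m rowsub f m)).
suff eqF : map_mx F (\det M *: m)
           = map_mx F (A *m (colsub g 1%:M *m (\adj M *m rowsub f m))).
  apply/matrixP=> i j; apply: injF.
  by move/matrixP/(_ i j): eqF; rewrite !mxE.
rewrite map_mxZ !map_mxM -/A'.
have col_A' : colsub g A' = E *m map_mx F M.
  have -> : colsub g A' = colsub g (E *m rowsub f A') by rewrite -def_A'.
  rewrite -mulmx_colsub; congr (_ *m _).
  by apply/matrixP=> i j; rewrite !mxE.
have -> : A' *m (map_mx F (colsub g 1%:M)
                 *m (map_mx F (\adj M) *m map_mx F (rowsub f m)))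
          = colsub g A' *m (\adj (map_mx F M) *m rowsub f (map_mx F m)).
  rewrite map_mxsub map_mx1 mulmxA mulmx_colsub mulmx1 map_mx_adj.
  by congr (_ *m (_ *m _)); rewrite map_mxsub.
rewrite col_A' -mulmxA (mulmxA (map_mx F M)) mul_mx_adj det_map_mx.
by rewrite mul_scalar_mx -scalemxAr -def_m'.
Qed.

(** * Torsion of a graded cokernel *)

(** The cokernel of L : k[t]^Y -> k[t]^X is the direct sum of its graded pieces,
    each the cokernel of a matrix with at most n rows. Treating the pieces
    separately gives a bound on the torsion in terms of n instead of the size
    of X. *)
Section GradedCokernel.
Variables (k : fieldType) (X Y : finType) (Gamma : eqType).
Variables (gradeX : X -> Gamma) (gradeY : Y -> Gamma) (L : X -> Y -> {poly k}).
Variables (n D : nat).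
Hypothesis L_graded : forall x y, L x y != 0 -> gradeX x = gradeY y.
Hypothesis size_L : forall x y, (size (L x y) <= D.+1)%N.
Hypothesis card_grade : forall c, (#|[set x | gradeX x == c]%SET| <= n)%N.

Definition in_image (s : X -> {poly k}) : Prop :=
  exists w : Y -> {poly k}, forall x, s x = \sum_y L x y * w y.

Definition grade_annihilator (s : X -> {poly k}) (c : Gamma) : set {poly k} :=
  [set r | exists w : Y -> {poly k},
     forall x, gradeX x = c -> r * s x = \sum_y L x y * w y].

Lemma grade_annihilator_ideal s c : is_ideal (grade_annihilator s c).
Proof.
split=> [|a b [v def_v] [w def_w]|a b [w def_w]].
- exists (fun=> 0) => x _; rewrite mul0r big1 // => y _; exact: mulr0.
- exists (fun y => v y + w y) => x xc.
  rewrite mulrDl def_v // def_w // -big_split.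
  by apply: eq_bigr => y _; rewrite mulrDr.
- exists (fun y => a * w y) => x xc.
  by rewrite -mulrA def_w // mulr_sumr; apply: eq_bigr => y _; rewrite mulrCA.
Qed.

(** Preimages found degree by degree are glued along the degrees of Y, since
    L only links equal degrees. *)
Lemma in_image_grade r s :
  in_image (fun x => r * s x) <-> forall c, grade_annihilator s c r.
Proof.
split=> [[w def_w] c|]; first by exists w.
move=> /choice[w def_w]; exists (fun y => w (gradeY y) y) => x.
rewrite (def_w (gradeX x)) //; apply: eq_bigr => y _.
by have [->|/L_graded->] := eqVneq (L x y) 0; rewrite ?mul0r.
Qed.

Lemma grade_torsion c : exists d : {poly k},
  [/\ d != 0, (size d <= (n * D).+1)%N &
      forall h s, h != 0 -> grade_annihilator s c h -> grade_annihilator s c d].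
Proof.
pose A := [set x | gradeX x == c]%SET.
pose M : 'M[{poly k}]_(#|A|, #|Y|) :=
  \matrix_(i, j) L (enum_val i) (enum_val j).
have szM i j : (size (M i j) <= D.+1)%N by rewrite mxE.
have [d [d0 le_d tors_d]] := matrix_torsion szM.
exists d; split=> // [|h s h0 [w def_w]].
  by apply: leq_trans le_d _; rewrite ltnS leq_mul2r card_grade orbT.
have [|w' def_w'] :=
    tors_d h (\col_i s (enum_val i)) (\col_j w (enum_val j)) h0.
  apply/colP=> i; rewrite !mxE def_w; last first.
    by have := enum_valP i; rewrite inE => /eqP.
  rewrite (reindex _ (onW_bij _ (enum_val_bij Y))) /=.
  by apply: eq_bigr => j _; rewrite !mxE.
exists (fun y => w' (enum_rank y) 0) => x xc.
have xA : x \in A by rewrite inE xc.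
have /colP/(_ (enum_rank_in xA x)) := def_w'.
rewrite !mxE enum_rankK_in // => ->.
rewrite (reindex _ (onW_bij _ (enum_val_bij Y))) /=.
by apply: eq_bigr => j _; rewrite mxE enum_rankK_in // enum_valK.
Qed.

Lemma graded_finite_torsion : exists2 d : {poly k}, d != 0 &
  forall h s, h != 0 -> in_image (fun x => h * s x) ->
    in_image (fun x => d * s x).
Proof.
have [d specd] := choice grade_torsion.
exists (\prod_x d (gradeX x)).
  by apply/prodf_neq0 => x _; case: (specd (gradeX x)).
move=> h s h0 /in_image_grade Ks; apply/in_image_grade => c.
have [[x xc] | noc] := EM (exists x, gradeX x = c); last first.
  by exists (fun=> 0) => x xc; case: noc; exists x.
have [_ _ KM] := grade_annihilator_ideal s c.
rewrite (bigD1 x) //= mulrC xc; apply: KM.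
by have [_ _ tors_d] := specd c; apply: tors_d (Ks c).
Qed.

Lemma graded_linear_torsion (g : {poly k}) j N s :
    irreducible_poly g -> (n * D <= N)%N ->
  in_image (fun x => g ^+ j * s x) -> in_image (fun x => g ^+ N * s x).
Proof.
move=> irr_g le_N /in_image_grade Ks; apply/in_image_grade => c.
have [d [d0 le_d tors_d]] := grade_torsion c.
have gj0 : g ^+ j != 0 by rewrite expf_neq0 ?irredp_neq0.
have idK := grade_annihilator_ideal s c.
apply: (ideal_irreducible_power idK irr_g d0 _ _ (Ks c)).
  exact: leq_trans le_d _.
exact: tors_d (Ks c).
Qed.

End GradedCokernel.

(** * Polynomials modulo the q-th powers of the variables *)

Section Box.
Variables (m q : nat) (P : comNzRingType).
Local Notation S := {mpoly P[m]}.
Local Notation box := {ffun 'I_m -> 'I_q}.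

Definition box_mnm (a : box) : 'X_{1..m} := [multinom nat_of_ord (a i) | i < m].

Definition shifted_coef (F : S) (a b : 'X_{1..m}) : P :=
  if (b <= a)%MM then F@_(a - b) else 0.

Lemma mcoeffMX_shift (F : S) a b : (F * 'X_[b])@_a = shifted_coef F a b.
Proof.
rewrite /shifted_coef; case: ifPn => [le_ba | nle_ba].
  by rewrite -{1}(submK le_ba) addmC mcoeffMX.
rewrite [F]mpolyE mulr_suml raddf_sum big1_seq // => c _ /=.
rewrite -scalerAl -mpolyXD mcoeffZ mcoeffX.
case: eqP => [eq_a|]; last by rewrite mulr0.
by rewrite -eq_a lem_addl in nle_ba.
Qed.

Definition var_powers : set S :=
  [set s | exists v : 'I_m -> S, s = \sum_i v i * 'X_i ^+ q].

Lemma var_powers_ideal : is_ideal var_powers.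
Proof.
split=> [|_ _ [v ->] [w ->]|a _ [v ->]].
- by exists (fun=> 0); rewrite big1 // => i _; rewrite mul0r.
- exists (fun i => v i + w i); rewrite -big_split.
  by apply: eq_bigr => i _; rewrite mulrDl.
- exists (fun i => a * v i); rewrite mulr_sumr.
  by apply: eq_bigr => i _; rewrite mulrA.
Qed.

(** Membership in (X_1^q, ..., X_m^q) is monomial: a monomial is in this ideal
    unless all its exponents are below q. *)
Lemma var_powersE s : var_powers s <-> forall a, s@_(box_mnm a) = 0.
Proof.
split=> [[v ->] a | s0].
  rewrite raddf_sum big1 // => i _ /=; rewrite mpolyXn mcoeffMX_shift.
  rewrite /shifted_coef ifN //; apply/mnm_lepP => /(_ i).
  by rewrite mulmnE mnm1E eqxx mul1n mnmE leqNgt ltn_ord.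
have [T0 TD TM] := var_powers_ideal.
rewrite [s]mpolyE big_seq; apply: (big_ind var_powers) => // c s_c.
have [i le_qi] : exists i, (q <= c i)%N.
  apply: contrapT => small; have lt_cq i : (c i < q)%N.
    by rewrite ltnNge; apply/negP => le_qi; apply: small; exists i.
  move: s_c; rewrite mcoeff_msupp => /eqP; apply.
  rewrite -(s0 [ffun i => Ordinal (lt_cq i)]); congr (_@__).
  by apply/mnmP => i; rewrite mnmE ffunE.
have le_c : (U_(i) *+ q <= c)%MM.
  apply/mnm_lepP => j; rewrite mulmnE mnm1E.
  by case: eqP => [<-|_]; rewrite ?mul1n ?mul0n.
rewrite -(submK le_c) mpolyXD -mpolyXn -mul_mpolyC mulrA; apply: TM.
exists (fun j => (j == i)%:R); rewrite (bigD1 i) //= eqxx mul1r big1 ?addr0 //.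
by move=> j /negPf->; rewrite mul0r.
Qed.

Lemma box_truncation (s : S) (c : box -> P) :
  (forall a, c a = s@_(box_mnm a)) ->
  var_powers (s - \sum_a c a *: 'X_[box_mnm a]).
Proof.
move=> def_c; apply/var_powersE => a; apply/eqP.
rewrite mcoeffB subr_eq0 raddf_sum (bigD1 a) //= mcoeffZ mcoeffX eqxx mulr1.
rewrite def_c big1 ?addr0 // => b neq_ba; rewrite mcoeffZ mcoeffX.
case: eqP => [/mnmP eq_ba|]; last by rewrite mulr0.
case/eqP: neq_ba; apply/ffunP => i; apply/val_inj.
by have := eq_ba i; rewrite !mnmE.
Qed.

(** The quotient by F and the q-th powers of the variables is the cokernel of a
    finite matrix with entries coefficients of F: multiplication by F on the
    span of the monomials with exponents below q. *)
Lemma mod_box (F s : S) :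
  (exists w, var_powers (s - w * F)) <->
  exists c : box -> P, forall a,
    s@_(box_mnm a) = \sum_b shifted_coef F (box_mnm a) (box_mnm b) * c b.
Proof.
have [T0 TD TM] := var_powers_ideal.
have coefE (c : box -> P) a :
    ((\sum_b c b *: 'X_[box_mnm b]) * F)@_(box_mnm a)
      = \sum_b shifted_coef F (box_mnm a) (box_mnm b) * c b.
  rewrite mulr_suml raddf_sum; apply: eq_bigr => b _ /=.
  by rewrite -scalerAl mcoeffZ mulrC (mulrC 'X_[_]) mcoeffMX_shift.
split=> [[w Tw] | [c def_s]].
  exists (fun b => w@_(box_mnm b)) => a; rewrite -coefE; apply/eqP.
  rewrite -subr_eq0 -mcoeffB; apply/eqP; move: a; apply/var_powersE.
  set W := \sum_b _.
  have -> : s - W * F = (s - w * F) + F * (w - W).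
    by rewrite (mulrC F) mulrBl addrA subrK.
  by apply: (TD) => //; apply: TM; apply: box_truncation.
exists (\sum_b c b *: 'X_[box_mnm b]); apply/var_powersE => a.
by rewrite mcoeffB coefE def_s subrr.
Qed.

End Box.

(** * The quartic equation as a graded matrix *)

Section Quartic.
Variables (k : fieldType) (q : nat) (r0 r1 r2 : {poly k}).
Local Notation P := {poly k}.
Local Notation S := {mpoly P[4]}.
Local Notation box := {ffun 'I_4 -> 'I_q}.
Local Notation u := (@Ordinal 4 0 isT).
Local Notation v := (@Ordinal 4 1 isT).
Local Notation x := (@Ordinal 4 2 isT).
Local Notation y := (@Ordinal 4 3 isT).

Definition quartic : S :=
  r0%:MP * 'X_u ^+ 2 * 'X_x ^+ 2 + r1%:MP * 'X_u * 'X_x * 'X_v * 'X_y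
  + r2%:MP * 'X_v ^+ 2 * 'X_y ^+ 2.

Definition quartic_height : nat := maxn (size r0) (maxn (size r1) (size r2)).

(** The grading of u^a v^b x^c y^d for which the three monomials of the equation
    have the same degree (2,2,2). The shift [d] is 2 on the source of the
    multiplication by the equation and 0 on its target, which makes this
    multiplication preserve degrees. *)
Definition grade (d : nat) (a : box) : nat * nat * nat :=
  (a u + a v + d, a x + a y + d, a u + a y + d)%N.

Definition quartic_mod : set S :=
  [set s | exists w, var_powers q (s - w * quartic)].

Lemma mcoeff_quartic c : quartic@_c =
  r0 * ((U_(u) + (U_(u) + U_(x) *+ 2))%MM == c)%:R
  + r1 * ((U_(u) + (U_(x) + (U_(v) + U_(y))))%MM == c)%:R
  + r2 * ((U_(v) + (U_(v) + U_(y) *+ 2))%MM == c)%:R.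
Proof.
by rewrite /quartic -!mulrA !mpolyXn -!mpolyXD !mcoeffD !mcoeffCM !mcoeffX.
Qed.

Lemma quartic_homogeneous c : quartic@_c != 0 ->
  [/\ c u + c v = 2, c x + c y = 2 & c u + c y = 2]%N.
Proof.
rewrite mcoeff_quartic.
case: (_ =P c) => [<- _|_]; first by rewrite !mnmDE ?mulmnE !mnm1E.
case: (_ =P c) => [<- _|_]; first by rewrite !mnmDE !mnm1E.
case: (_ =P c) => [<- _|_]; first by rewrite !mnmDE ?mulmnE !mnm1E.
by rewrite !mulr0 !addr0 eqxx.
Qed.

Lemma size_quartic c : (size quartic@_c <= quartic_height)%N.
Proof.
have bool_size (r : P) (b : bool) : (size (r * b%:R)%R <= size r)%N.
  by case: b; rewrite ?mulr1 ?mulr0 ?size_poly0.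
rewrite mcoeff_quartic /quartic_height.
apply: leq_trans (size_polyD _ _) _; rewrite geq_max; apply/andP; split.
  apply: leq_trans (size_polyD _ _) _; rewrite geq_max.
  by rewrite !(leq_trans (bool_size _ _)) // !leq_max leqnn ?orbT.
by rewrite (leq_trans (bool_size _ _)) // !leq_max leqnn ?orbT.
Qed.

Let L (a b : box) := shifted_coef quartic (box_mnm a) (box_mnm b).

Lemma quartic_graded a b : L a b != 0 -> grade 0 a = grade 2 b.
Proof.
rewrite /L /shifted_coef; case: ifP => [/mnm_lepP le_ba|]; last by rewrite eqxx.
move/quartic_homogeneous; rewrite !mnmBE => -[uv xy uy].
have := le_ba u; have := le_ba v; have := le_ba x; have := le_ba y.
move: uv xy uy; rewrite !mnmE /grade !addn0 => uv xy uy ley lex lev leu.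
have sum2 i j i' j' : (i <= i' -> j <= j' -> i' - i + (j' - j) = 2 ->
    i' + j' = i + j + 2)%N.
  by move=> le_i le_j <-; rewrite addnACA !subnKC.
by congr (_, _, _); apply: sum2.
Qed.

Lemma size_quartic_shift a b : (size (L a b) <= quartic_height.+1)%N.
Proof.
rewrite /L /shifted_coef; case: ifP => _; last by rewrite size_poly0.
by rewrite leqW // size_quartic.
Qed.

(** In a fixed degree the exponent of u determines the other three. *)
Lemma card_quartic_grade c : (#|[set a | grade 0 a == c]%SET| <= q)%N.
Proof.
rewrite -[X in (_ <= X)%N]card_ord.
apply: (@leq_card_in _ _ (fun a : box => a u)).
move=> a b; rewrite !inE => /eqP <- /eqP[]; rewrite !addn0 => uv xy uy eq_u.
have eq_v : b v = a v by apply/val_inj/eqP; rewrite -(eqn_add2l (a u)) -uv eq_u.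
have eq_y : b y = a y by apply/val_inj/eqP; rewrite -(eqn_add2l (a u)) -uy eq_u.
have eq_x : b x = a x by apply/val_inj/eqP; rewrite -(eqn_add2r (a y)) -xy eq_y.
apply/ffunP => i; have : i \in [:: u; v; x; y].
  by case: i => -[|[|[|[|]]]].
by rewrite !inE => /or4P[] /eqP->.
Qed.

Lemma quartic_modE r s : quartic_mod (r%:MP * s) <->
  in_image L (fun a => r * s@_(box_mnm a)).
Proof.
rewrite /quartic_mod /= mod_box /in_image.
by split=> -[c def_c]; exists c => a; move: (def_c a); rewrite mcoeffCM.
Qed.

Lemma quartic_finite_torsion : exists2 h : P, h != 0 &
  forall r s, r != 0 -> quartic_mod (r%:MP * s) -> quartic_mod (h%:MP * s).
Proof.
have [h h0 tors_h] :=
  graded_finite_torsion quartic_graded size_quartic_shift card_quartic_grade.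
exists h => // r s r_n0 /quartic_modE rs; apply/quartic_modE.
exact: tors_h rs.
Qed.

Lemma quartic_linear_torsion (g : P) j s : irreducible_poly g ->
    quartic_mod ((g ^+ j)%:MP * s) ->
  quartic_mod ((g ^+ (quartic_height.+1 * q))%:MP * s).
Proof.
move=> irr_g /quartic_modE gs; apply/quartic_modE.
apply: (graded_linear_torsion quartic_graded size_quartic_shift
          card_quartic_grade irr_g _ gs).
by rewrite mulnC leq_mul2r leqnSn orbT.
Qed.

Lemma quartic_mod_inert r : (0 < q)%N -> quartic_mod r%:MP -> r = 0.
Proof.
move=> q_gt0 [w /var_powersE/(_ [ffun=> Ordinal q_gt0])].
have -> : box_mnm [ffun=> Ordinal q_gt0] = 0%MM :> 'X_{1..4}.
  by apply/mnmP => i; rewrite mnmE ffunE mnm0E.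
have -> : (r%:MP - w * quartic)@_0 = r - w@_0%MM * quartic@_0%MM.
  by rewrite mcoeffB mcoeffC eqxx mulr1 rmorphM.
have -> : quartic@_0 = 0.
  by apply/eqP/contraT => /quartic_homogeneous[]; rewrite !mnm0E.
by rewrite mulr0 subr0.
Qed.

End Quartic.

(** * The hypersurface ring over k[t] *)

Section Transfer.
Variables (k : fieldType) (r0 r1 r2 : {poly k}).
Local Notation P := {poly k}.
Local Notation A := {mpoly k[5]}.
Local Notation S := {mpoly P[4]}.
Local Notation H := (hypersurface r0 r1 r2).
Local Notation f := (hypersurface_eq r0 r1 r2).
Local Notation F := (quartic r0 r1 r2).

Definition in_t_rmorph : {rmorphism P -> A} :=
  horner_eval ('X_(@Ordinal 5 0 isT) : A) \o map_poly (@mpolyC 5 k).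

Definition pi_rmorph : {rmorphism A -> H} :=
  \pi_({ideal_quot (hypersurface_ideal r0 r1 r2)})%qT.

Definition t_morph : {rmorphism P -> H} := pi_rmorph \o in_t_rmorph.

(** Variable 0 of the five is t and moves into the coefficients, so that the
    variables 1, 2, 3, 4 become 0, 1, 2, 3; [lift ord0] is this shift. *)
Definition collect_var (i : 'I_5) : S :=
  if unlift ord0 i is Some j then 'X_j else ('X : P)%:MP.

Definition collect : {rmorphism A -> S} :=
  mmap (@mpolyC 4 P \o @polyC k) collect_var.

Definition expand : {rmorphism S -> A} :=
  mmap in_t_rmorph (fun j => 'X_(lift ord0 j)).

Lemma expand_collect a : expand (collect a) = a.
Proof.
have var i : expand (collect_var i) = 'X_i.
  rewrite /collect_var; case: unliftP => [j|] ->; rewrite /expand /=.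
    by rewrite mmapX mmap1U.
  rewrite mmapC /= map_polyX /horner_eval hornerX.
  by congr 'X_(_); apply/val_inj.
elim/mpolyind: a => [|c m a _ _ IHa]; first by rewrite !rmorph0.
rewrite !rmorphD IHa; congr (_ + _); rewrite -mul_mpolyC !rmorphM.
congr (_ * _).
  by rewrite /collect /expand /= !mmapC /= map_polyC /horner_eval hornerC.
rewrite [in RHS]mpolyXE_id [in LHS]/collect /= mmapX /mmap1 rmorph_prod.
by apply: eq_bigr => i _; rewrite rmorphXn /= var.
Qed.

Lemma collect_in_t r : collect (in_t_rmorph r) = r%:MP.
Proof.
elim/poly_ind: r => [|r c IHr]; first by rewrite !rmorph0.
rewrite !rmorphD !rmorphM IHr; congr (_ * _ + _).
  rewrite /= map_polyX /horner_eval hornerX /collect /= mmapX mmap1U.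
  by rewrite /collect_var; case: unliftP => // j /(congr1 val).
by rewrite /= map_polyC /horner_eval hornerC /collect /= mmapC.
Qed.

Lemma collect_var_lift j : collect 'X_(lift ord0 j) = 'X_j.
Proof. by rewrite /collect /= mmapX mmap1U /collect_var liftK. Qed.

Lemma ord5_lift : [/\ @Ordinal 5 1 isT = lift ord0 (@Ordinal 4 0 isT),
  @Ordinal 5 2 isT = lift ord0 (@Ordinal 4 1 isT),
  @Ordinal 5 3 isT = lift ord0 (@Ordinal 4 2 isT) &
  @Ordinal 5 4 isT = lift ord0 (@Ordinal 4 3 isT)].
Proof. by split; apply/val_inj. Qed.

Lemma collect_hypersurface_eq : collect f = F.
Proof.
have [e1 e2 e3 e4] := ord5_lift.
have in_tE r : in_t r = in_t_rmorph r by [].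
rewrite /hypersurface_eq e1 e2 e3 e4 !in_tE.
by rewrite !(rmorphD, rmorphM, rmorphXn) /= !collect_var_lift !collect_in_t.
Qed.

Lemma pi_eq0 a : pi_rmorph a = 0 <-> exists h, a = h * f.
Proof.
rewrite -(rmorph0 pi_rmorph); split.
  by move/eqP; rewrite -Quotient.idealrBE subr0 => /asboolP.
move=> [h def_a]; apply/eqP; rewrite -Quotient.idealrBE subr0.
by apply/asboolP; exists h.
Qed.

Lemma pi_surj z : exists a, z = pi_rmorph a.
Proof. by exists (repr z); rewrite /= reprK. Qed.

Variables (p e : nat).
Hypothesis p_char : p \in [pchar k].
Local Notation q := (p ^ e)%N.
Local Notation I := (ideal_uvxy r0 r1 r2).
Local Notation J := (frob_pow I q).

Lemma hypersurface_pchar : p \in [pchar H].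
Proof.
apply: (rmorph_pchar t_morph); exact: (rmorph_pchar (@polyC k)).
Qed.

Lemma q_pnat : [pchar H].-nat q.
Proof.
have pH := hypersurface_pchar.
by rewrite pnatX (pnatE _ (pcharf_prime pH)) pH.
Qed.

Lemma uvxy_var j : I (pi_rmorph 'X_(lift ord0 j)).
Proof.
have [e1 e2 e3 e4] := ord5_lift; apply: sub_gen_smallest.
have : j \in [:: @Ordinal 4 0 isT; @Ordinal 4 1 isT; @Ordinal 4 2 isT;
                 @Ordinal 4 3 isT] by case: j => -[|[|[|[|]]]].
rewrite !inE => /or4P[] /eqP->; rewrite -?e1 -?e2 -?e3 -?e4.
- by left; left; left.
- by left; left; right.
- by left; right.
- by right.
Qed.

(** Both sides say that a is in the ideal (f, u^q, v^q, x^q, y^q) of the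
    polynomial ring. *)
Lemma frob_uvxyE a : J (pi_rmorph a) <-> quartic_mod q r0 r1 r2 (collect a).
Proof.
have [J0 JD JM] : is_ideal J by exact: gen_ideal_is_ideal.
have [T0 TD TM] := var_powers_ideal 4 q P.
split=> [Ja | [w [v def_a]]].
  suff [b eq_ab [w Tw]] :
      [set z | exists2 b, z = pi_rmorph b & quartic_mod q r0 r1 r2 (collect b)]
        (pi_rmorph a).
    have /pi_eq0[h def_ab] : pi_rmorph (a - b) = 0.
      by rewrite rmorphB eq_ab subrr.
    have def_ca : collect a = collect b + collect h * F.
      by rewrite -collect_hypersurface_eq -rmorphM -def_ab rmorphB addrC subrK.
    exists (w + collect h).
    by rewrite def_ca mulrDl (addrC (w * F)) opprD addrA addrK.
  move: Ja; rewrite /ideal_uvxy frob_pow_gen ?hypersurface_pchar //.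
  apply: smallest_sub.
    split=> [|_ _ [b -> [w Tw]] [c -> [w' Tw']] | y _ [b -> [w Tw]]].
    - exists 0; rewrite ?rmorph0 //; exists 0.
      by rewrite mul0r subr0.
    - exists (b + c); first by rewrite rmorphD.
      exists (w + w'); rewrite rmorphD mulrDl opprD addrACA; exact: TD.
    - have [c ->] := pi_surj y; exists (c * b); first by rewrite rmorphM.
      by exists (collect c * w); rewrite rmorphM -mulrA -mulrBr; apply: TM.
  have varq j : exists2 b, pi_rmorph 'X_(lift ord0 j) ^+ q = pi_rmorph b &
      quartic_mod q r0 r1 r2 (collect b).
    exists ('X_(lift ord0 j) ^+ q); first by rewrite rmorphXn.
    exists 0; rewrite mul0r subr0 rmorphXn /= collect_var_lift.
    exists (fun i => (i == j)%:R); rewrite (bigD1 j) //= eqxx mul1r.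
    by rewrite big1 ?addr0 // => i /negPf->; rewrite mul0r.
  have [e1 e2 e3 e4] := ord5_lift.
  move=> _ [_ [[[] | ] | ] -> <-]; rewrite /= ?e1 ?e2 ?e3 ?e4; exact: varq.
have /(congr1 expand) := def_a.
rewrite rmorphB rmorphM -collect_hypersurface_eq !expand_collect => /eqP.
rewrite subr_eq rmorph_sum => /eqP ->; rewrite rmorphD; apply: (JD).
  rewrite rmorph_sum; apply: (big_ind J) => // j _.
  rewrite !rmorphM; apply: JM; rewrite !rmorphXn; apply: sub_gen_smallest.
  exists (pi_rmorph 'X_(lift ord0 j)); first exact: uvxy_var.
  by congr (_ ^+ _); rewrite /expand /= mmapX mmap1U.
suff -> : pi_rmorph (expand w * f) = 0 by [].
by apply/pi_eq0; exists (expand w).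
Qed.

(** An element of R minus its value at u = v = x = y = 0 is in I, so its q-th
    power is in J. *)
Lemma frob_uvxy_retract z : exists r, J (z ^+ q - t_morph (r ^+ q)).
Proof.
have [I0 ID IM] : is_ideal I by exact: gen_ideal_is_ideal.
have [J0 JD JM] : is_ideal J by exact: gen_ideal_is_ideal.
suff [r Ir] : exists r, I (z - t_morph r).
  exists r; have : J ((z - t_morph r) ^+ q).
    by apply: sub_gen_smallest; exists (z - t_morph r).
  by rewrite exprDn_pchar ?exprNn_pchar ?q_pnat // -rmorphXn.
have [a ->] := pi_surj z; rewrite -[a]expand_collect.
elim/mpolyind: (collect a) => [|c m s _ _ [r Ir]].
  by exists 0; rewrite !rmorph0 subrr.
have [-> | /eqP m_neq0] := eqVneq m 0%MM.
  exists (c + r); rewrite mpolyX0 -mul_mpolyC mulr1.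
  rewrite !rmorphD opprD addrACA; apply: ID => //.
  by rewrite {1}/expand /= mmapC subrr.
have [i mi] : exists i, m i != 0%N.
  apply: contrapT => m0; apply: m_neq0; apply/mnmP => i; rewrite mnm0E.
  by apply/eqP/contraT => mi; case: m0; exists i.
exists r; rewrite !rmorphD -addrA; apply: ID => //.
rewrite -lep1mP in mi; rewrite -(submK mi) mpolyXD -mul_mpolyC mulrA !rmorphM.
by apply: IM; rewrite {1}/expand /= mmapX mmap1U; apply: uvxy_var.
Qed.

Lemma t_morphM r a : J (t_morph r * pi_rmorph a) <->
  quartic_mod q r0 r1 r2 (r%:MP * collect a).
Proof.
rewrite -[t_morph r]/(pi_rmorph (in_t_rmorph r)) -rmorphM frob_uvxyE.
by rewrite rmorphM collect_in_t.
Qed.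

End Transfer.

Theorem theorem4p8 (k : fieldType) (p : nat) (hp : p \in [pchar k])
    (r0 r1 r2 : {poly k}) (hr02 : r0 * r2 != 0)
    (hdeg : ((size r0).-1 + (size r2).-1 < 2 * (size r1).-1)%N) :
  exists c : nat, (0 < c)%N /\
    forall e : nat,
      exists (s : nat) (Q : 'I_s -> set (hypersurface r0 r1 r2)),
        is_primary_decomposition (frob_pow (ideal_uvxy r0 r1 r2) (p ^ e)%N) Q /\
        forall i : 'I_s,
          frob_pow (ideal_pow (radical (Q i)) c) (p ^ e)%N `<=` Q i.
Proof.
exists (quartic_height r0 r1 r2).+1; split=> // e.
apply: (@decomposition_of_torsion _ _ (t_morph r0 r1 r2)) => //.
- exact: q_pnat.
- exact: gen_ideal_is_ideal.
- exact: frob_uvxy_retract.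
- move=> r; rewrite -[t_morph _ _ _ r]mulr1 -(rmorph1 (pi_rmorph r0 r1 r2)).
  rewrite t_morphM // rmorph1 mulr1; apply: quartic_mod_inert.
  by rewrite expn_gt0 (prime_gt0 (pcharf_prime hp)).
- have [h h0 tors_h] := quartic_finite_torsion (p ^ e) r0 r1 r2.
  exists h => // z [h' h'0]; have [a ->] := pi_surj z.
  by rewrite !t_morphM //; apply: tors_h.
- move=> g j z irr_g; have [a ->] := pi_surj z.
  by rewrite !t_morphM //; apply: quartic_linear_torsion.
Qed.
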